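(* Assume: (A3) there are $L_{\hat F},l_{\hat F}>0$ with $\|\nabla F_i(x)-\nabla F_i(y)\|\le L_{\hat F}\|x-y\|$ and $|F_i(x)^2-F_i(y)^2|\le l_{\hat F}\|x-y\|$ for all $x,y$ and all $i$; (A4) there is $M_{\hat G}>0$ with $\|\hat G'(x,B)\|\le M_{\hat G}$ for all $x$ and all $B\subseteq\mathcal B$ with $|B|\in\{1,\dots,m\}$; (A5) there is $P_{\hat g_1}>0$ with $\hat g_1(x,B)\le P_{\hat g_1}$ for all such $x,B$; (A6) there is $\sigma>0$ with $\mathbb E_q|\hat g_2(x,B)-\hat f_2(x)|^2\le\sigma^2$ for all $x$ when $|B|=1$. Let $\{x_k\}$ be generated by Scheme 3 with update rule (15), $\tau_k=\hat g_1(x_k,B_k)$, $\eta_k\in[\eta,1]$, $\eta\in(0,1]$. Then for $k\in\mathbb N$: $$\mathbb E\Big[\min_{i\in\{0,\dots,k-1\}}\|\nabla\hat f_2(x_i)\|^2\Big]\le\frac{8(M_{\hat G}^2+\gamma P_{\hat g_1}L_{\hat F})}{\eta(2-\eta)}\Big(\frac{\mathbb E[\hat f_2(x_0)]}{k}+2l_{\hat F}\min\Big\{\sqrt{\frac{2P_{\hat g_1}}{L}},\frac{M_{\hat G}}{L}\Big\}\mathbb 1_{\{b<m\}}+\tilde\sigma\sqrt{\frac1b-\frac1m}\Big),$$ where $\tilde\sigma=\sigma\sqrt{m/(m-1)}$.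
   Context: Let $F_1,\dots,F_m:\mathbb R^n\to\mathbb R$ be smooth, $\mathcal B=\{F_1,\dots,F_m\}$, $\hat F(x)=\frac1{\sqrt m}(F_1(x),\dots,F_m(x))^\top$, $\hat f_1=\|\hat F\|$, $\hat f_2=\hat f_1^2$. Euclidean norms; spectral norm for matrices. For a batch $B=\{F_{i_1},\dots,F_{i_b}\}\subseteq\mathcal B$, $\hat G(x,B)=\frac1{\sqrt b}(F_{i_1}(x),\dots,F_{i_b}(x))^\top$ with Jacobian $\hat G'(x,B)$, $\hat g_1(x,B)=\|\hat G(x,B)\|$, $\hat g_2=\hat g_1^2$. Batches of size $b\in\{1,\dots,m\}$ are drawn uniformly among subsets of size $b$ (without replacement; $q$ is this distribution), independently at each iteration and of the iterates; $x_0$ may be random, independent of the batches; $\mathbb E$ is expectation over all randomness. Stochastic local model $\hat\psi_{x,L,\tau}(y,B)=\frac\tau2+\frac L2\|y-x\|^2+\frac1{2\tau}\|\hat G(x,B)+\hat G'(x,B)(y-x)\|^2$. Rule (15): $x_{k+1}=x_k-\eta_k\big(\hat G'(x_k,B_k)^*\hat G'(x_k,B_k)+\tau_kL_kI_n\big)^{-1}\hat G'(x_k,B_k)^*\hat G(x_k,B_k)$. Scheme 3 (input $x_0$; $\gamma\ge1$; $L\in(0,\gamma L_{\hat F}]$, $L_0=L$; batch size $b$). For $k=0,1,\dots$: (1) sample $B_k$; (2) choose $\tau_k$; (3) compute $x_{k+1}$ by the chosen rule; (4) if $\hat g_1(x_{k+1},B_k)>\hat\psi_{x_k,L_k,\tau_k}(x_{k+1},B_k)$,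 set $L_k:=\min\{2L_k,\gamma L_{\hat F}\}$ and return to (2); (5) $L_{k+1}=\max\{L_k/2,L\}$. *)

(* Defs.v *)
From HB Require Import structures.
From mathcomp Require Import all_boot all_order all_algebra.
From mathcomp Require Import all_classical all_reals all_analysis.


Unset Printing Implicit Defensive.
Import Order.TTheory GRing.Theory Num.Theory.
Import numFieldNormedType.Exports.
Local Open Scope ring_scope.
Local Open Scope classical_set_scope.

Section SGN.
Variable R : realType.

Definition enorm {p : nat} (v : 'cV[R]_p) : R := Num.sqrt (\sum_(i < p) v i 0 ^+ 2).

Definition opnorm {p q : nat} (A : 'M[R]_(p, q)) : R :=
  sup [set enorm (A *m v) | v in [set v : 'cV[R]_q | enorm v = 1]].

Variable n : nat.

Definition grad (f : 'cV[R]_n -> R) (x : 'cV[R]_n) : 'cV[R]_n :=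
  \col_(i < n) ('D_(delta_mx i 0) f x).

Variable m : nat.
Variable F : 'I_m -> 'cV[R]_n -> R.

Definition Fhat (x : 'cV[R]_n) : 'cV[R]_m :=
  \col_(i < m) (F i x / Num.sqrt m%:R).
Definition fhat1 x := enorm (Fhat x).
Definition fhat2 x := fhat1 x ^+ 2.

(* batch B (a subset of {F_1..F_m}, indexed by 'I_m); its elements are listed
   by enum_val, and b = #|B| *)
Definition Ghat (x : 'cV[R]_n) (B : {set 'I_m}) : 'cV[R]_#|B| :=
  \col_(j < #|B|) (F (enum_val j) x / Num.sqrt (#|B|%:R)).
Definition Gjac (x : 'cV[R]_n) (B : {set 'I_m}) : 'M[R]_(#|B|, n) :=
  \matrix_(j < #|B|, c < n) (grad (F (enum_val j)) x c 0 / Num.sqrt (#|B|%:R)).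
Definition ghat1 x B := enorm (Ghat x B).
Definition ghat2 x B := ghat1 x B ^+ 2.

Definition psi (x : 'cV[R]_n) (L tau : R) (y : 'cV[R]_n) (B : {set 'I_m}) : R :=
  tau / 2 + L / 2 * enorm (y - x) ^+ 2
  + (2 * tau)^-1 * enorm (Ghat x B + Gjac x B *m (y - x)) ^+ 2.

Definition rule15 (x : 'cV[R]_n) (B : {set 'I_m}) (eta tau L : R) : 'cV[R]_n :=
  x - eta *: (invmx ((Gjac x B)^T *m Gjac x B + (tau * L)%:M)
               *m ((Gjac x B)^T *m Ghat x B)).

Definition Ltrial (gLF L0 : R) (j : nat) : R :=
  iter j (fun l => Num.min (2 * l) gLF) L0.

Definition accept (x : 'cV[R]_n) (B : {set 'I_m}) (eta L : R) : Prop :=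
  ghat1 (rule15 x B eta (ghat1 x B) L) B
    <= psi x L (ghat1 x B) (rule15 x B eta (ghat1 x B) L) B.

Definition scheme3_run (gamma LF Lmin : R) (etas : nat -> R)
  (Bs : nat -> {set 'I_m}) (x0 : 'cV[R]_n)
  (xs : nat -> 'cV[R]_n) (Ls : nat -> R) : Prop :=
  xs 0%N = x0 /\ Ls 0%N = Lmin /\
  forall k, exists j : nat,
    accept (xs k) (Bs k) (etas k) (Ltrial (gamma * LF) (Ls k) j) /\
    (forall j', (j' < j)%N ->
       ~ accept (xs k) (Bs k) (etas k) (Ltrial (gamma * LF) (Ls k) j')) /\
    xs k.+1 = rule15 (xs k) (Bs k) (etas k) (ghat1 (xs k) (Bs k))
                     (Ltrial (gamma * LF) (Ls k) j) /\
    Ls k.+1 = Num.max (Ltrial (gamma * LF) (Ls k) j / 2) Lmin.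

Definition Eq (b : nat) (f : {set 'I_m} -> R) : R :=
  (\sum_(B : {set 'I_m} | #|B| == b) f B)
    / (#|[set B : {set 'I_m} | #|B| == b]|%:R).

(* expectation over k i.i.d. uniform batches of size b (B_0,...,B_{k-1});
   later batches (irrelevant for x_0..x_k) are set to a fixed batch of size b *)
Definition default_batch (b : nat) : {set 'I_m} := [set i : 'I_m | (i < b)%N].

Definition extend_batches (b k : nat) (t : {ffun 'I_k -> {set 'I_m}})
  : nat -> {set 'I_m} :=
  fun j => match @insub nat (fun j => (j < k)%N) 'I_k j with
           | Some i => t i | None => default_batch b end.

Definition batch_seqs (b k : nat) :=
  [set t : {ffun 'I_k -> {set 'I_m}} | [forall i, #|t i| == b]].

Definition Ebatches (b k : nat) (f : (nat -> {set 'I_m}) -> R) : R :=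
  (\sum_(t in batch_seqs b k) f (extend_batches b k t))
    / (#|batch_seqs b k|%:R).

End SGN.

Arguments enorm {R p}.
Arguments opnorm {R p q}.
Arguments grad {R n}.
Arguments Fhat {R n m}.
Arguments fhat1 {R n m}.
Arguments fhat2 {R n m}.
Arguments Ghat {R n m}.
Arguments Gjac {R n m}.
Arguments ghat1 {R n m}.
Arguments ghat2 {R n m}.
Arguments psi {R n m}.
Arguments rule15 {R n m}.
Arguments Ltrial {R}.
Arguments accept {R n m}.
Arguments scheme3_run {R n m}.
Arguments Eq {R m}.
Arguments default_batch {m}.
Arguments extend_batches {m}.
Arguments batch_seqs {m}.
Arguments Ebatches {R m}.

(* Main.v *)
(* Let G and J be the batch residual and Jacobian at x, t = |G|, A = J^T J + t l I
   and y = x - e A^-1 J^T G. Expanding the model gives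
     psi(y) = t - e (2 - e) <A^-1 J^T G, J^T G> / (2 t),
   so the acceptance test bounds |J^T G|^2 by a multiple of
   ghat2(x, B) - ghat2(y, B). Since |y - x| is bounded by the minimum in the
   statement, the Lipschitz condition replaces ghat2 by fhat2 at the cost
   2 lF |y - x| (no cost if B is the full batch), for every realisation of the
   batches. Thus the sum over the iterations telescopes pathwise, and the sigma
   term is only slack. Randomness enters once: by Jensen, |grad fhat2 (x_i)|^2 is
   at most the average over B of |grad ghat2 (x_i, B)|^2, and as x_i depends only
   on the batches drawn before step i, resampling the i-th batch turns this
   average into the expectation over all batches. *)
Require Import Defs.
From HB Require Import structures.
From mathcomp Require Import all_boot all_order all_algebra perm.
From mathcomp Require Import all_classical all_reals all_analysis.
From mathcomp Require Import measurable_realfun ring lra.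
Import Order.TTheory GRing.Theory Num.Theory.
Import numFieldNormedType.Exports.
Local Open Scope ring_scope.
Local Open Scope classical_set_scope.
Set Implicit Arguments.
Unset Strict Implicit.

Definition dotp {R : realType} {p : nat} (u v : 'cV[R]_p) : R := (u^T *m v) 0 0.

Section dot_product.
Variable R : realType.

Lemma dotpE p (u v : 'cV[R]_p) : dotp u v = \sum_i u i 0 * v i 0.
Proof. by rewrite /dotp mxE; apply: eq_bigr => i _; rewrite mxE. Qed.

Lemma dotpC p (u v : 'cV[R]_p) : dotp u v = dotp v u.
Proof. by rewrite !dotpE; apply: eq_bigr => i _; rewrite mulrC. Qed.

Lemma dotpDl p (u v w : 'cV[R]_p) : dotp (u + v) w = dotp u w + dotp v w.
Proof. by rewrite /dotp linearD mulmxDl mxE. Qed.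

Lemma dotpDr p (u v w : 'cV[R]_p) : dotp u (v + w) = dotp u v + dotp u w.
Proof. by rewrite dotpC dotpDl !(dotpC u). Qed.

Lemma dotpZl p a (u v : 'cV[R]_p) : dotp (a *: u) v = a * dotp u v.
Proof. by rewrite /dotp linearZ -scalemxAl mxE. Qed.

Lemma dotpZr p a (u v : 'cV[R]_p) : dotp u (a *: v) = a * dotp u v.
Proof. by rewrite dotpC dotpZl dotpC. Qed.

Lemma dotp_mulmxl p q (A : 'M[R]_(p, q)) u v : dotp (A *m u) v = dotp u (A^T *m v).
Proof. by rewrite /dotp trmx_mul mulmxA. Qed.

Lemma dotp_ge0 p (u : 'cV[R]_p) : 0 <= dotp u u.
Proof. by rewrite dotpE; apply: sumr_ge0 => i _; rewrite -expr2 sqr_ge0. Qed.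

Lemma dotp_eq0 p (u : 'cV[R]_p) : dotp u u = 0 -> u = 0.
Proof.
rewrite dotpE => /eqP; rewrite psumr_eq0 => [/allP u0|i _]; last first.
  by rewrite -expr2 sqr_ge0.
apply/colP => i; have := u0 i (mem_index_enum i).
by rewrite -expr2 sqrf_eq0 mxE => /eqP.
Qed.

Lemma dotp_gt0 p (u : 'cV[R]_p) : u != 0 -> 0 < dotp u u.
Proof.
by move=> u0; rewrite lt_def dotp_ge0 andbT; apply: contraNneq u0 => /dotp_eq0 ->.
Qed.

Lemma enormE p (u : 'cV[R]_p) : enorm u = Num.sqrt (dotp u u).
Proof. by rewrite dotpE. Qed.

Lemma enorm_ge0 p (u : 'cV[R]_p) : 0 <= enorm u.
Proof. exact: sqrtr_ge0. Qed.

Lemma enorm_sqr p (u : 'cV[R]_p) : enorm u ^+ 2 = dotp u u.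
Proof. by rewrite enormE sqr_sqrtr// dotp_ge0. Qed.

Lemma enorm_eq0 p (u : 'cV[R]_p) : enorm u = 0 -> u = 0.
Proof. by move=> u0; apply: dotp_eq0; rewrite -enorm_sqr u0 expr0n. Qed.

Lemma enorm0 p : enorm (0 : 'cV[R]_p) = 0.
Proof. by rewrite enormE /dotp mulmx0 mxE sqrtr0. Qed.

Lemma enormZ p a (u : 'cV[R]_p) : enorm (a *: u) = `|a| * enorm u.
Proof.
by rewrite !enormE dotpZl dotpZr mulrA -expr2 sqrtrM ?sqr_ge0// sqrtr_sqr.
Qed.

Lemma enormN p (u : 'cV[R]_p) : enorm (- u) = enorm u.
Proof. by rewrite -scaleN1r enormZ normrN1 mul1r. Qed.

Lemma cauchy_schwarz_sqr p (u v : 'cV[R]_p) :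
  dotp u v ^+ 2 <= dotp u u * dotp v v.
Proof.
have [->|/dotp_gt0 v0] := eqVneq v 0.
  by rewrite /dotp !mulmx0 mxE mulr0 expr0n.
have := dotp_ge0 (dotp v v *: u - dotp u v *: v).
rewrite -scaleNr !(dotpDl, dotpDr, dotpZl, dotpZr) (dotpC v u) => h.
rewrite -subr_ge0 -(pmulr_lge0 _ v0).
by apply: le_trans h _; rewrite le_eqVlt; apply/orP; left; apply/eqP; ring.
Qed.

Lemma cauchy_schwarz p (u v : 'cV[R]_p) : dotp u v <= enorm u * enorm v.
Proof.
apply: le_trans (ler_norm _) _.
rewrite -ler_sqr ?nnegrE ?mulr_ge0 ?enorm_ge0//.
by rewrite real_normK ?num_real// exprMn !enorm_sqr cauchy_schwarz_sqr.
Qed.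

Lemma enorm_mulmx_frobenius p q (A : 'M[R]_(p, q)) v :
  enorm (A *m v) ^+ 2 <= (\sum_i \sum_j A i j ^+ 2) * enorm v ^+ 2.
Proof.
rewrite !enorm_sqr (dotpE (A *m v)) mulr_suml; apply: ler_sum => i _.
have -> : (A *m v) i 0 = dotp (row i A)^T v.
  by rewrite /dotp trmxK -row_mul [RHS]mxE.
rewrite -expr2; apply: le_trans (cauchy_schwarz_sqr _ _) _.
rewrite le_eqVlt; apply/orP; left; apply/eqP; congr (_ * _).
by rewrite dotpE; apply: eq_bigr => j _; rewrite !mxE expr2.
Qed.

Lemma opnorm_ge p q (A : 'M[R]_(p, q)) v : enorm (A *m v) <= opnorm A * enorm v.
Proof.
have [->|v0] := eqVneq v 0; first by rewrite mulmx0 !enorm0 mulr0.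
have ev0 : 0 < enorm v by rewrite lt_def enorm_ge0 andbT; apply: contraNneq v0 => /enorm_eq0 ->.
rewrite -ler_pdivrMr// mulrC -[X in X * _]gtr0_norm ?invr_gt0// -enormZ scalemxAr.
apply: ub_le_sup; last first.
  by exists ((enorm v)^-1 *: v) => //=; rewrite enormZ gtr0_norm ?invr_gt0// mulVf ?gt_eqF.
exists (Num.sqrt (\sum_i \sum_j A i j ^+ 2)) => _ [w /= w1 <-].
rewrite -[leLHS]ger0_norm ?enorm_ge0// -sqrtr_sqr ler_wsqrtr//.
by apply: le_trans (enorm_mulmx_frobenius A w) _; rewrite w1 expr1n mulr1.
Qed.

Section damped_step.
Variables (p q : nat) (J : 'M[R]_(p, q)) (M s : R).
Hypotheses (M0 : 0 <= M) (s0 : 0 < s) (JM : opnorm J <= M).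

Let A := J^T *m J + s%:M.

Lemma opnorm_le_enorm v : enorm (J *m v) <= M * enorm v.
Proof. by apply: le_trans (opnorm_ge _ _) _; rewrite ler_wpM2r ?enorm_ge0. Qed.

Lemma opnorm_le_enorm_tr u : enorm (J^T *m u) <= M * enorm u.
Proof.
have [->|w0] := eqVneq (enorm (J^T *m u)) 0; first by rewrite mulr_ge0// enorm_ge0.
have wp : 0 < enorm (J^T *m u) by rewrite lt_def w0 enorm_ge0.
rewrite -(ler_pM2r wp) -expr2 enorm_sqr dotp_mulmxl trmxK.
apply: le_trans (cauchy_schwarz _ _) _.
rewrite [M * _]mulrC -mulrA ler_wpM2l ?enorm_ge0//; exact: opnorm_le_enorm.
Qed.

Lemma dotp_damped v : dotp v (A *m v) = dotp (J *m v) (J *m v) + s * dotp v v.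
Proof.
by rewrite /A mulmxDl dotpDr mul_scalar_mx dotpZr dotp_mulmxl mulmxA.
Qed.

Lemma damped_unitmx : A \in unitmx.
Proof.
rewrite unitmxE unitfE; apply/det0P => -[w w0 wA].
have := dotp_damped w^T.
have -> : A *m w^T = 0.
  apply: trmx_inj; rewrite trmx_mul trmxK trmx0 /A linearD /= trmx_mul trmxK.
  by rewrite tr_scalar_mx.
rewrite {1}/dotp mulmx0 mxE => /esym h.
have wT0 : w^T != 0 by apply: contraNneq w0 => wT; rewrite -(trmxK w) wT trmx0.
suff : 0 < dotp (J *m w^T) (J *m w^T) + s * dotp w^T w^T by rewrite h ltxx.
by rewrite ltr_wpDl ?dotp_ge0// mulr_gt0// dotp_gt0.
Qed.

Lemma dotp_damped_le v :
  dotp (A *m v) (A *m v) <= (M ^+ 2 + s) * dotp v (A *m v).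
Proof.
rewrite dotp_damped /A mulmxDl mul_scalar_mx -mulmxA.
have zv : dotp (J^T *m (J *m v)) v = dotp (J *m v) (J *m v).
  by rewrite dotp_mulmxl trmxK.
rewrite !(dotpDl, dotpDr, dotpZl, dotpZr) (dotpC v) zv.
have h1 : dotp (J *m v) (J *m v) <= M ^+ 2 * dotp v v.
  rewrite -!enorm_sqr -exprMn lerXn2r ?nnegrE ?mulr_ge0 ?enorm_ge0//.
  exact: opnorm_le_enorm.
have h2 : dotp (J^T *m (J *m v)) (J^T *m (J *m v)) <= M ^+ 2 * dotp (J *m v) (J *m v).
  rewrite -!enorm_sqr -exprMn lerXn2r ?nnegrE ?mulr_ge0 ?enorm_ge0//.
  exact: opnorm_le_enorm_tr.
have := ler_wpM2l (ltW s0) h1; nra.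
Qed.

End damped_step.
End dot_product.

Section gauss_newton_step.
Variables (R : realType) (n m : nat) (F : 'I_m -> 'cV[R]_n -> R).

Lemma ghat1_ge0 x B : 0 <= ghat1 F x B.
Proof. exact: enorm_ge0. Qed.

Lemma ghat2E x B : ghat2 F x B = #|B|%:R^-1 * \sum_(i in B) F i x ^+ 2.
Proof.
rewrite big_enum_val /ghat2 /ghat1 enorm_sqr dotpE mulr_sumr.
apply: eq_bigr => i _; rewrite !mxE -expr2 exprMn exprVn sqr_sqrtr ?ler0n//.
by rewrite mulrC.
Qed.

Lemma fhat2E x : fhat2 F x = m%:R^-1 * \sum_i F i x ^+ 2.
Proof.
rewrite /fhat2 /fhat1 enorm_sqr dotpE mulr_sumr.
apply: eq_bigr => i _; rewrite !mxE -expr2 exprMn exprVn sqr_sqrtr ?ler0n//.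
by rewrite mulrC.
Qed.

Lemma Gjac_tr_GhatE x B c :
  ((Gjac F x B)^T *m Ghat F x B) c 0 =
  #|B|%:R^-1 * \sum_(i in B) F i x * grad (F i) x c 0.
Proof.
rewrite big_enum_val mxE mulr_sumr; apply: eq_bigr => i _; rewrite !mxE.
rewrite mulrACA -invfM -expr2 sqr_sqrtr ?ler0n//.
by rewrite mulrC [X in _ * X]mulrC.
Qed.

Lemma grad_fhat2E x c : (forall i, differentiable (F i) x) ->
  grad (fhat2 F) x c 0 = 2 * (m%:R^-1 * \sum_i F i x * grad (F i) x c 0).
Proof.
move=> dF; rewrite mxE.
have -> : fhat2 F = m%:R^-1 \*: (\sum_i (F i ^+ 2)).
  by apply/funext => y; rewrite fhat2E /= fct_sumE.
have dFi i : derivable (F i) x (delta_mx c 0) by exact: diff_derivable.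
rewrite deriveZ; last by apply: derivable_sum => i; exact: derivableX.
rewrite derive_sum; last by move=> i; exact: derivableX.
rewrite /GRing.scale /= mulrCA; congr (_ * _).
rewrite mulr_sumr; apply: eq_bigr => i _.
by rewrite deriveX// mxE expr1 /GRing.scale /= mulr_natl mulrA mulr_natl.
Qed.

Lemma ghat2_setT x : ghat2 F x [set: 'I_m]%SET = fhat2 F x.
Proof.
rewrite ghat2E fhat2E cardsT card_ord; congr (_ * _).
by apply: eq_bigl => i; rewrite inE.
Qed.

Section lipschitz.
Variable l : R.
Hypothesis Flip : forall i x y, `|F i x ^+ 2 - F i y ^+ 2| <= l * enorm (x - y).

Lemma ghat2_lipschitz x y (B : {set 'I_m}) : (0 < #|B|)%N ->
  `|ghat2 F x B - ghat2 F y B| <= l * enorm (x - y).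
Proof.
move=> B0; rewrite !ghat2E -mulrBr -sumrB normrM ger0_norm ?invr_ge0//.
rewrite mulrC ler_pdivrMr ?ltr0n//.
apply: le_trans (ler_norm_sum _ _ _) _.
apply: le_trans (ler_sum _ (fun i _ => Flip i x y)) _.
by rewrite sumr_const mulr_natr.
Qed.

Lemma fhat2_lipschitz x y : (0 < m)%N ->
  `|fhat2 F x - fhat2 F y| <= l * enorm (x - y).
Proof.
by move=> m0; rewrite -!ghat2_setT ghat2_lipschitz// cardsT card_ord.
Qed.

End lipschitz.

Section step.
Variables (M Lmin Lmax Pg : R) (x : 'cV[R]_n) (B : {set 'I_m}) (e l : R).
Hypotheses (M0 : 0 <= M) (Lmin0 : 0 < Lmin) (Lminl : Lmin <= l) (lLmax : l <= Lmax).
Hypotheses (e01 : 0 < e <= 1).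
Hypotheses (JM : opnorm (Gjac F x B) <= M) (GP : ghat1 F x B <= Pg).

Let J := Gjac F x B.
Let G := Ghat F x B.
Let t := ghat1 F x B.
Let y := rule15 F x B e t l.
Let A := J^T *m J + (t * l)%:M.
Let v := invmx A *m (J^T *m G).

Hypothesis acc : accept F x B e l.

Lemma rule15_stationary : t = 0 -> J^T *m G = 0 /\ y = x.
Proof.
move=> /enorm_eq0 G0.
have g0 : J^T *m G = 0 by rewrite /G G0 mulmx0.
by split=> //; rewrite /y /rule15 -/J -/G g0 mulmx0 scaler0 subr0.
Qed.

Let l0 : 0 < l. Proof. exact: lt_le_trans Lmin0 Lminl. Qed.

Section positive_residual.
Hypothesis t0 : 0 < t.

Let s0 : 0 < t * l. Proof. exact: mulr_gt0. Qed.

Let Av : A *m v = J^T *m G.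
Proof. by rewrite mulKVmx// damped_unitmx. Qed.

Let yx : y - x = - (e *: v).
Proof. by rewrite /y /rule15 addrAC subrr add0r. Qed.

Let a := dotp v (J^T *m G).

Let aE : a = dotp (J *m v) (J *m v) + (t * l) * dotp v v.
Proof. by rewrite /a -Av dotp_damped. Qed.

Let a0 : 0 <= a.
Proof. by rewrite aE addr_ge0 ?dotp_ge0// mulr_ge0 ?dotp_ge0// ltW. Qed.

Lemma psi_rule15 : psi F x l t y B = t - e * (2 - e) * a / (2 * t).
Proof.
rewrite /psi yx -scaleNr -scalemxAr !enorm_sqr -/J -/G.
rewrite !(dotpDl, dotpDr, dotpZl, dotpZr) (dotpC (J *m v) G).
have -> : dotp G (J *m v) = a by rewrite dotpC dotp_mulmxl.
have -> : dotp G G = t ^+ 2 by rewrite -enorm_sqr.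
have -> : dotp (J *m v) (J *m v) = a - (t * l) * dotp v v by rewrite aE; ring.
by field; rewrite gt_eqF.
Qed.

Let decrease : e * (2 - e) * a <= 2 * (t * (t - ghat1 F y B)).
Proof.
have : ghat1 F y B <= psi F x l t y B := acc.
rewrite psi_rule15 lerBrDr addrC -lerBrDr ler_pdivrMr ?mulr_gt0// => h.
by apply: le_trans h _; rewrite le_eqVlt; apply/orP; left; apply/eqP; ring.
Qed.

Let ee0 : 0 < e * (2 - e).
Proof. by case/andP: e01 => h1 h2; rewrite mulr_gt0//; lra. Qed.

Let residual_le : ghat1 F y B <= t.
Proof.
have := le_trans (mulr_ge0 (ltW ee0) a0) decrease.
by rewrite !pmulr_rge0// subr_ge0.
Qed.

Lemma step_decrease_pos :
  e * (2 - e) * dotp (J^T *m G) (J^T *m G) <=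
  2 * (M ^+ 2 + Pg * Lmax) * (ghat2 F x B - ghat2 F y B).
Proof.
have h1 : dotp (J^T *m G) (J^T *m G) <= (M ^+ 2 + Pg * Lmax) * a.
  rewrite /a -Av; apply: le_trans (dotp_damped_le M0 s0 JM v) _.
  rewrite ler_wpM2r ?Av// lerD2l ler_pM// ?ltW//.
have h2 : t * (t - ghat1 F y B) <= ghat2 F x B - ghat2 F y B.
  rewrite /ghat2 -/t; have := ghat1_ge0 y B; move: residual_le; nra.
have c0 : 0 <= M ^+ 2 + Pg * Lmax.
  by rewrite addr_ge0 ?sqr_ge0// mulr_ge0//; [exact: le_trans (ltW t0) GP|
     exact: le_trans (ltW l0) lLmax].
apply: le_trans (ler_wpM2l (ltW ee0) h1) _.
rewrite mulrCA -mulrA -[leRHS]mulrCA ler_wpM2l//.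
apply: le_trans decrease _; by rewrite ler_wpM2l.
Qed.

Lemma step_length_sqrt_pos : enorm (y - x) <= Num.sqrt (2 * Pg / Lmin).
Proof.
rewrite -[leLHS]ger0_norm ?enorm_ge0// -sqrtr_sqr ler_wsqrtr//.
rewrite ler_pdivlMr//.
have h1 : psi F x l t y B <= t.
  rewrite psi_rule15 gerBl divr_ge0 ?(mulr_ge0 (ltW ee0))//.
  by rewrite mulr_ge0// ltW.
have h2 : 0 <= t / 2 + (2 * t)^-1 * enorm (G + J *m (y - x)) ^+ 2.
  apply: addr_ge0; first by rewrite divr_ge0// ltW.
  by rewrite mulr_ge0 ?sqr_ge0// invr_ge0 mulr_ge0// ltW.
move: h1; rewrite /psi -/J -/G => h1.
have h3 := ler_wpM2l (sqr_ge0 (enorm (y - x))) Lminl.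
move: GP; rewrite -/t; lra.
Qed.

Lemma step_length_div_pos : enorm (y - x) <= M / Lmin.
Proof.
case/andP: e01 => e0 e1.
rewrite yx enormN enormZ gtr0_norm//.
apply: (@le_trans _ _ (enorm v)); first by rewrite ler_piMl// enorm_ge0.
have [v0|v0] := eqVneq (enorm v) 0; first by rewrite v0 divr_ge0// ltW.
have vp : 0 < enorm v by rewrite lt_def v0 enorm_ge0.
apply: (@le_trans _ _ (M / l)); last by rewrite ler_wpM2l// lef_pV2.
rewrite ler_pdivlMr// -(ler_pM2l t0) -(ler_pM2l vp).
have -> : enorm v * (t * (enorm v * l)) = (t * l) * dotp v v.
  by rewrite -enorm_sqr; ring.
apply: (@le_trans _ _ a); first by rewrite aE lerDr dotp_ge0.
apply: le_trans (cauchy_schwarz _ _) _; rewrite ler_wpM2l ?enorm_ge0//.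
by rewrite [t * M]mulrC; exact: opnorm_le_enorm_tr.
Qed.

End positive_residual.

Lemma step_decrease :
  e * (2 - e) * dotp (J^T *m G) (J^T *m G) <=
  2 * (M ^+ 2 + Pg * Lmax) * (ghat2 F x B - ghat2 F y B).
Proof.
have [/rule15_stationary [-> ->]|t0] := eqVneq t 0.
  by rewrite subrr /dotp mulmx0 mxE !mulr0.
by apply: step_decrease_pos; rewrite lt_def t0 ghat1_ge0.
Qed.

Lemma step_length : enorm (y - x) <= Num.min (Num.sqrt (2 * Pg / Lmin)) (M / Lmin).
Proof.
have [/rule15_stationary [_ ->]|t0] := eqVneq t 0.
  by rewrite subrr enorm0 le_min sqrtr_ge0 divr_ge0// ltW.
have tp : 0 < t by rewrite lt_def t0 ghat1_ge0.
by rewrite le_min step_length_sqrt_pos// step_length_div_pos.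
Qed.

End step.
End gauss_newton_step.

Lemma sqr_sum_le (R : realFieldType) (I : finType) (S : {set I}) (f : I -> R) :
  (0 < #|S|)%N ->
  (#|S|%:R^-1 * \sum_(i in S) f i) ^+ 2 <= #|S|%:R^-1 * \sum_(i in S) f i ^+ 2.
Proof.
move=> S0; have N0 : #|S|%:R != 0 :> R by rewrite pnatr_eq0 -lt0n.
set s := \sum_(i in S) f i; set mu := #|S|%:R^-1 * s.
have : 0 <= \sum_(i in S) (f i - mu) ^+ 2 by apply: sumr_ge0 => i _; exact: sqr_ge0.
under eq_bigr do rewrite sqrrB.
rewrite big_split sumrB /= [X in _ - X + _]sumrMnl -mulr_suml sumr_const -/s => h.
rewrite -subr_ge0 -(@pmulr_rge0 _ #|S|%:R) ?ltr0n//.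
apply: le_trans h _; rewrite le_eqVlt; apply/orP; left; apply/eqP.
by rewrite -[in LHS]mulr_natr -[in LHS]mulr_natl /mu; field.
Qed.

Definition draws (m b : nat) : {set {set 'I_m}} := [set B : {set 'I_m} | #|B| == b]%SET.

Section draws_lemmas.
Variables (m b : nat).
Hypothesis bm : (0 < b <= m)%N.
Local Notation S := (draws m b).

Lemma card_draws_gt0 : (0 < #|S|)%N.
Proof. by rewrite card_draws card_ord bin_gt0; case/andP: bm. Qed.

Lemma draws_mem_sym (R : nmodType) (c : bool -> R) (i j : 'I_m) :
  \sum_(B in S) c (i \in B) = \sum_(B in S) c (j \in B).
Proof.
rewrite (reindex_inj (imset_inj (@perm_inj _ (tperm i j)))) /=.
apply: eq_big => [B|B _]; first by rewrite !inE card_imset//; exact: perm_inj.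
by rewrite -{1}(tpermR i j) (mem_imset _ _ (@perm_inj _ _)).
Qed.

Lemma avg_draws (R : realFieldType) (a : 'I_m -> R) :
  #|S|%:R^-1 * \sum_(B in S) (#|B|%:R^-1 * \sum_(i in B) a i) = m%:R^-1 * \sum_i a i.
Proof.
have [b0 bm'] := andP bm.
have m0 : (0 < m)%N by exact: leq_trans bm'.
have mR : m%:R != 0 :> R by rewrite pnatr_eq0 -lt0n.
have bR : b%:R != 0 :> R by rewrite pnatr_eq0 -lt0n.
have NR : #|S|%:R != 0 :> R by rewrite pnatr_eq0 -lt0n card_draws_gt0.
pose c i : R := \sum_(B in S) (i \in B)%:R.
have cE i j : c i = c j by exact: (draws_mem_sym (fun x => x%:R) i j).
have sumc : \sum_i c i = b%:R * #|S|%:R.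
  rewrite exchange_big /= mulr_natr -sumr_const; apply: eq_bigr => B.
  rewrite inE => /eqP <-; rewrite -sum1_card [in RHS]big_mkcond natr_sum.
  by apply: eq_bigr => i _; case: (i \in B).
have cval i : c i = b%:R * #|S|%:R / m%:R.
  rewrite -sumc (eq_bigr (fun=> c i)) => [|j _]; last exact: cE.
  by rewrite sumr_const card_ord -[X in X / _]mulr_natr mulfK.
have -> : \sum_(B in S) (#|B|%:R^-1 * \sum_(i in B) a i) =
          b%:R^-1 * \sum_i a i * c i.
  rewrite /c; under [in RHS]eq_bigr do rewrite mulr_sumr.
  rewrite exchange_big mulr_sumr; apply: eq_bigr => B; rewrite inE => /eqP ->.
  congr (_ * _); rewrite big_mkcond; apply: eq_bigr => i _.
  by case: (i \in B); rewrite ?mulr1 ?mulr0.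
under eq_bigr do rewrite cval.
by rewrite -mulr_suml; field; rewrite NR bR mR.
Qed.

End draws_lemmas.

Lemma gradient_jensen (R : realType) (n m b : nat) (F : 'I_m -> 'cV[R]_n -> R) x :
  (0 < b <= m)%N -> (forall i, differentiable (F i) x) ->
  enorm (grad (fhat2 F) x) ^+ 2 <=
  #|draws m b|%:R^-1 * \sum_(B in draws m b)
    4 * enorm ((Gjac F x B)^T *m Ghat F x B) ^+ 2.
Proof.
move=> bm dF; rewrite enorm_sqr dotpE.
under eq_bigr do rewrite -expr2 grad_fhat2E// -(avg_draws bm) exprMn.
under [in leRHS]eq_bigr do rewrite enorm_sqr dotpE mulr_sumr.
rewrite exchange_big mulr_sumr; apply: ler_sum => c _.
under [in leRHS]eq_bigr do rewrite -expr2.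
rewrite -mulr_sumr [leRHS]mulrCA.
have -> : 2 ^+ 2 = 4 :> R by ring.
rewrite ler_wpM2l//.
apply: le_trans (sqr_sum_le _ (card_draws_gt0 bm)).
rewrite le_eqVlt; apply/orP; left; apply/eqP; congr ((_ * _) ^+ 2).
by apply: eq_bigr => B _; rewrite Gjac_tr_GhatE.
Qed.

Section resampling.
Variables (I V : finType) (S : {set V}).

Definition resample (t : {ffun I -> V}) (i : I) (v : V) : {ffun I -> V} :=
  [ffun j => if j == i then v else t j].

Lemma resample_at t i v : resample t i v i = v.
Proof. by rewrite ffunE eqxx. Qed.

Lemma resample_other t i v j : j != i -> resample t i v j = t j.
Proof. by rewrite ffunE => /negbTE ->. Qed.

(* (t, v) |-> (t with its i-th entry replaced by v, t i) is an involution. *)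
Lemma sum_resample (R : nmodType) (H : {ffun I -> V} -> R) i :
  \sum_(t in ffun_on (mem S)) \sum_(v in S) H (resample t i v) =
  (\sum_(t in ffun_on (mem S)) H t) *+ #|S|.
Proof.
pose swap (p : {ffun I -> V} * V) := (resample p.1 i p.2, p.1 i).
have swapK : involutive swap.
  move=> [t v]; rewrite /swap /= resample_at; congr (_, _).
  by apply/ffunP => j; rewrite !ffunE; case: eqVneq => // ->.
rewrite pair_big /= (reindex_inj (inv_inj swapK)) /=.
rewrite -sumrMnl; under [in RHS]eq_bigr do rewrite -sumr_const.
rewrite pair_big /=; apply: eq_big => [[t v]|[t v] _] /=; last first.
  by rewrite (_ : resample _ _ _ = (swap (swap (t, v))).1)// swapK.
apply/andP/andP => -[/ffun_onP tS vS]; split.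
- apply/ffun_onP => j; have := tS j.
  by rewrite ffunE; case: eqVneq => // ->.
- by have := tS i; rewrite resample_at.
- by apply/ffun_onP => j; rewrite ffunE; case: ifP.
- exact: tS.
Qed.

End resampling.

Section scheme.
Variables (R : realType) (n m : nat) (F : 'I_m -> 'cV[R]_n -> R).
Variables (gamma LF L : R) (etas : nat -> R).

Lemma scheme3_run_prefix Bs Bs' x0 xs xs' Ls Ls' i :
  scheme3_run F gamma LF L etas Bs x0 xs Ls ->
  scheme3_run F gamma LF L etas Bs' x0 xs' Ls' ->
  (forall j, (j < i)%N -> Bs j = Bs' j) ->
  xs i = xs' i /\ Ls i = Ls' i.
Proof.
move=> [x0E [L0E st]] [x0E' [L0E' st']].
elim: i => [|i ih] BB; first by rewrite x0E x0E' L0E L0E'.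
have [xE LE] := ih (fun j ji => BB j (ltnW ji)).
have [j [a1 [r1 [-> ->]]]] := st i.
have [j' [a2 [r2 [-> ->]]]] := st' i.
rewrite -xE -LE -(BB i (ltnSn i)) in a2 r2 *.
have [/r2/(_ a1)[]|/r1/(_ a2)[]|->] := ltngtP j j'.
by split.
Qed.

Hypotheses (L0 : 0 < L) (L1 : L <= gamma * LF).

Lemma Ltrial_bounds l j :
  L <= l <= gamma * LF -> L <= Ltrial (gamma * LF) l j <= gamma * LF.
Proof.
move=> lb; elim: j => [//|j /andP[ih1 ih2]] /=.
rewrite le_min L1 ge_min lexx orbT !andbT.
by apply: (le_trans ih1); rewrite mulr_natl mulr2n lerDl (le_trans (ltW L0)).
Qed.

Lemma scheme3_run_step Bs x0 xs Ls k :
  scheme3_run F gamma LF L etas Bs x0 xs Ls ->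
  exists2 l, L <= l <= gamma * LF &
    accept F (xs k) (Bs k) (etas k) l /\
    xs k.+1 = rule15 F (xs k) (Bs k) (etas k) (ghat1 F (xs k) (Bs k)) l.
Proof.
move=> [_ [L0E st]].
have Lb : L <= Ls k <= gamma * LF.
  elim: k => [|k /andP[ih1 ih2]]; first by rewrite L0E lexx.
  have [j [_ [_ [_ ->]]]] := st k.
  have /andP[h1 h2] := @Ltrial_bounds _ j (introT andP (conj ih1 ih2)).
  rewrite le_max lexx orbT ge_max L1 andbT /=.
  apply: (le_trans _ h2); rewrite ler_pdivrMr// mulr_natr mulr2n lerDl.
  by rewrite (le_trans (ltW L0)).
have [j [a [_ [xE _]]]] := st k.
by exists (Ltrial (gamma * LF) (Ls k) j); [exact: Ltrial_bounds|].
Qed.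

End scheme.

Lemma batch_seqsE m b k (t : {ffun 'I_k -> {set 'I_m}}) :
  (t \in batch_seqs b k) = (t \in ffun_on (mem (draws m b))).
Proof.
apply/idP/ffun_onP => [/set_mem/= /fintype.forallP tb i|tb].
  by rewrite inE; exact: tb.
by apply/mem_set/fintype.forallP => i; have := tb i; rewrite inE.
Qed.

Lemma card_batch_seqs_gt0 m b k : (0 < b <= m)%N -> (0 < #|@batch_seqs m b k|)%N.
Proof.
move=> bm; have /card_gt0P[B Bb] := card_draws_gt0 bm.
apply/card_gt0P; exists [ffun=> B]; rewrite batch_seqsE.
by apply/ffun_onP => i; rewrite ffunE.
Qed.

Lemma extend_batches_ord m b k (t : {ffun 'I_k -> {set 'I_m}}) (i : 'I_k) :
  extend_batches b k t i = t i.
Proof. by rewrite /extend_batches valK. Qed.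

Lemma card_default_batch m b : (b <= m)%N -> #|@default_batch m b| = b.
Proof.
move=> bm; rewrite -sum1_card; under eq_bigl do rewrite inE.
by rewrite (big_ord_narrow bm) /= sum1_card card_ord.
Qed.

Lemma card_extend_batches m b k (t : {ffun 'I_k -> {set 'I_m}}) j :
  (b <= m)%N -> t \in batch_seqs b k -> #|extend_batches b k t j| = b.
Proof.
move=> bm; rewrite batch_seqsE => /ffun_onP tb; rewrite /extend_batches.
case: insubP => [i _ _|_]; last exact: card_default_batch.
by have := tb i; rewrite inE => /eqP.
Qed.

Section descent.
Variables (R : realType) (n m : nat) (F : 'I_m -> 'cV[R]_n -> R).
Hypothesis HF : forall i x, differentiable (F i) x.
Variables (LF lF MG Pg : R).
Hypotheses (HlF : 0 < lF).
Hypothesis HA3b : forall i x y, `|F i x ^+ 2 - F i y ^+ 2| <= lF * enorm (x - y).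
Hypothesis HMG : 0 < MG.
Hypothesis HA4 : forall x (B : {set 'I_m}), (0 < #|B|)%N -> opnorm (Gjac F x B) <= MG.
Hypothesis HPg : 0 < Pg.
Hypothesis HA5 : forall x (B : {set 'I_m}), (0 < #|B|)%N -> ghat1 F x B <= Pg.
Variables (gamma L : R) (b : nat).
Hypotheses (HL0 : 0 < L) (HL1 : L <= gamma * LF) (Hb : (1 <= b <= m)%N).
Variables (eta : R) (etas : nat -> R).
Hypotheses (Heta : 0 < eta <= 1) (Hetas : forall k, eta <= etas k <= 1).

Let C := 8 * (MG ^+ 2 + gamma * Pg * LF) / (eta * (2 - eta)).
Let delta := 2 * lF * Num.min (Num.sqrt (2 * Pg / L)) (MG / L) * (if (b < m)%N then 1 else 0).
Let g x B := (Gjac F x B)^T *m Ghat F x B.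

Let ee0 : 0 < eta * (2 - eta).
Proof. by case/andP: Heta => h1 h2; rewrite mulr_gt0//; lra. Qed.

Lemma rate_const_ge0 : 0 <= C.
Proof.
rewrite divr_ge0 ?(ltW ee0)// mulr_ge0// addr_ge0 ?sqr_ge0//.
by rewrite mulrAC mulr_ge0 ?(ltW HPg)// (le_trans (ltW HL0)).
Qed.

Lemma step_bias_ge0 : 0 <= delta.
Proof.
apply: mulr_ge0; last by case: ifP.
apply: mulr_ge0; first by rewrite mulr_ge0// ltW.
by rewrite le_min sqrtr_ge0 divr_ge0// ltW.
Qed.

Lemma run_step_decrease (Bs : nat -> {set 'I_m}) x0 (xs : nat -> 'cV[R]_n) Ls k :
  #|Bs k| = b ->
  scheme3_run F gamma LF L etas Bs x0 xs Ls ->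
  4 * enorm (g (xs k) (Bs k)) ^+ 2 <=
  C * (fhat2 F (xs k) - fhat2 F (xs k.+1) + delta).
Proof.
have [b0 bm] := andP Hb; move=> Bk run.
have B0 : (0 < #|Bs k|)%N by rewrite Bk.
have [l /andP[l1 l2] [acc ->]] := @scheme3_run_step _ _ _ _ _ _ _ _ HL0 HL1 _ _ _ _ k run.
have /andP[e1 e2] := Hetas k.
have e01 : 0 < etas k <= 1 by rewrite e2 andbT (lt_le_trans _ e1)//; case/andP: Heta.
have dec := step_decrease (ltW HMG) HL0 l1 l2 e01 (HA4 _ B0) (HA5 _ B0) acc.
have len := step_length (ltW HMG) HL0 l1 e01 (HA4 (xs k) B0) (HA5 (xs k) B0).
set y := rule15 _ _ _ _ _ _ in dec len *.
have bias : ghat2 F (xs k) (Bs k) - ghat2 F y (Bs k) <=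
            fhat2 F (xs k) - fhat2 F y + delta.
  rewrite /delta; case: ltnP => bm'; last first.
    have -> : Bs k = [set: 'I_m]%SET.
      by apply/eqP; rewrite eqEcard finset.subsetT cardsT card_ord Bk.
    by rewrite !ghat2_setT mulr0 addr0.
  have := ghat2_lipschitz HA3b (xs k) y B0.
  have := fhat2_lipschitz HA3b y (xs k) (leq_trans b0 bm).
  rewrite -(enormN (y - xs k)) opprB.
  rewrite -(enormN (y - xs k)) opprB in len.
  have := ler_wpM2l (ltW HlF) len.
  move=> h1 /(le_trans (ler_norm _)) h2 /(le_trans (ler_norm _)) h3; lra.
apply: (@le_trans _ _ (C * (ghat2 F (xs k) (Bs k) - ghat2 F y (Bs k)))); last first.
  by rewrite ler_wpM2l// rate_const_ge0.
rewrite /C mulrAC ler_pdivlMr// enorm_sqr.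
have h : eta * (2 - eta) <= etas k * (2 - etas k) by nra.
have := ler_wpM2r (dotp_ge0 (g (xs k) (Bs k))) h.
move: dec; rewrite -/(g _ _); lra.
Qed.

Variable xs : 'cV[R]_n -> (nat -> {set 'I_m}) -> nat -> 'cV[R]_n.
Hypothesis Hxs : forall x0 (Bs : nat -> {set 'I_m}), (forall j, #|Bs j| = b) ->
  exists Ls : nat -> R, scheme3_run F gamma LF L etas Bs x0 (xs x0 Bs) Ls.

Lemma sum_gradient_le x0 k (i : 'I_k) :
  \sum_(t in batch_seqs b k) enorm (grad (fhat2 F) (xs x0 (extend_batches b k t) i)) ^+ 2
  <= \sum_(t in batch_seqs b k) 4 * enorm (g (xs x0 (extend_batches b k t) i) (t i)) ^+ 2.
Proof.
have [b0 bm] := andP Hb.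
have N0 : (0 : R) < #|draws m b|%:R by rewrite ltr0n card_draws_gt0.
pose H (t : {ffun 'I_k -> {set 'I_m}}) := 4 * enorm (g (xs x0 (extend_batches b k t) i) (t i)) ^+ 2.
rewrite -[leRHS]/(\sum_(t in batch_seqs b k) H t).
rewrite -(ler_pM2r N0) [leRHS]mulr_natr.
rewrite (eq_bigl _ _ (@batch_seqsE _ _ _)) [X in _ <= X *+ _](eq_bigl _ _ (@batch_seqsE _ _ _)).
rewrite -(sum_resample (draws m b) H i) mulr_suml; apply: ler_sum => t tb.
rewrite -ler_pdivlMr// mulrC.
apply: le_trans (gradient_jensen Hb (fun j => HF j _)) _.
rewrite ler_wpM2l ?invr_ge0 ?ler0n//; apply: ler_sum => B BS.
rewrite /H resample_at.
have cu : resample t i B \in batch_seqs b k.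
  rewrite batch_seqsE; apply/ffun_onP => j; rewrite ffunE; case: ifP => // _.
  by move/ffun_onP : tb.
have ct : t \in batch_seqs b k by rewrite batch_seqsE.
have [Ls run] := Hxs x0 (fun j => card_extend_batches j bm ct).
have [Ls' run'] := Hxs x0 (fun j => card_extend_batches j bm cu).
rewrite -(proj1 (scheme3_run_prefix run run' _)) // => j ji.
have jk : (j < k)%N := ltn_trans ji (ltn_ord i).
rewrite -[j]/(val (Ordinal jk)) !extend_batches_ord resample_other//.
by rewrite -val_eqE /= ltn_eqF.
Qed.

Lemma Ebatches_min_gradient_le x0 k : (0 < k)%N ->
  let gnorm2 := fun y : 'cV[R]_n => enorm (grad (fhat2 F) y) ^+ 2 in
  Ebatches b k (fun Bs => \big[Num.min/gnorm2 (xs x0 Bs 0%N)]_(i < k) gnorm2 (xs x0 Bs i))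
  <= C * (k%:R^-1 * fhat2 F x0 + delta).
Proof.
move=> k0; set gnorm2 := fun y => _; have [b0 bm] := andP Hb; rewrite /=.
have kR : (0 : R) < k%:R by rewrite ltr0n.
have TR : (0 : R) < #|@batch_seqs m b k|%:R by rewrite ltr0n card_batch_seqs_gt0.
rewrite /Ebatches ler_pdivrMr// -(ler_pM2l kR) mulr_sumr.
apply: (@le_trans _ _ (\sum_(t in batch_seqs b k) \sum_(i < k)
   gnorm2 (xs x0 (extend_batches b k t) i))).
  apply: ler_sum => t _; rewrite -[k%:R]/(k%:R : R) -[X in X%:R * _](card_ord k).
  rewrite mulr_natl -sumr_const; apply: ler_sum => i _.
  exact: bigmin_le.
rewrite exchange_big /=.
apply: le_trans (ler_sum _ (fun i _ => sum_gradient_le x0 i)) _.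
rewrite exchange_big /=.
apply: (@le_trans _ _ (\sum_(t in batch_seqs b k) (C * (fhat2 F x0 + k%:R * delta)))); last first.
  rewrite sumr_const -mulr_natl le_eqVlt; apply/orP; left; apply/eqP.
  by field; rewrite gt_eqF.
apply: ler_sum => t tb.
have [Ls run] := Hxs x0 (fun j => card_extend_batches j bm tb).
set X := xs x0 _ in run *.
apply: (@le_trans _ _ (\sum_(0 <= i < k) C * (fhat2 F (X i) - fhat2 F (X i.+1) + delta))).
  rewrite big_mkord; apply: ler_sum => i _.
  have := run_step_decrease (card_extend_batches i bm tb) run.
  by rewrite extend_batches_ord.
rewrite -mulr_sumr big_split /= ler_wpM2l ?rate_const_ge0//.
rewrite sumr_const_nat subn0 -[delta *+ k]mulr_natl lerD2r.
under eq_bigr do rewrite -opprB.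
rewrite sumrN telescope_sumr// opprB (proj1 run) gerBl.
exact: sqr_ge0.
Qed.

End descent.

Section integral_nonmeasurable.
Local Open Scope ereal_scope.
Import HBNNSimple.

(* The integral of a nonnegative function is a supremum over simple functions
   below it, which makes it monotone without any measurability. *)
Lemma ge0_le_integral_nonmeas d (T : measurableType d) (R : realType)
    (mu : {measure set T -> \bar R}) (f g : T -> \bar R) :
  (forall x, 0 <= f x) -> (forall x, f x <= g x) ->
  \int[mu]_x f x <= \int[mu]_x g x.
Proof.
move=> f0 fg; rewrite !ge0_integralTE// => [|x]; last exact: le_trans (fg x).
apply: ge_ereal_sup => _ /= [h hf <-]; apply: ereal_sup_ubound.
by exists h => // x; exact: le_trans (fg x).
Qed.

Lemma integral_le_affine_nonmeas d (T : measurableType d) (R : realType)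
    (P : probability T R) (f g : T -> R) (a c : R) :
  (0 < a)%R -> (0 <= c)%R -> (forall x, 0 <= f x)%R -> (forall x, 0 <= g x)%R ->
  (forall x, f x <= a * g x + c)%R ->
  \int[P]_x (f x)%:E <= a%:E * \int[P]_x (g x)%:E + c%:E.
Proof.
move=> a0 c0 f0 g0 fg.
rewrite ge0_integralTE; last by move=> x; rewrite lee_fin.
apply: ge_ereal_sup => _ /= [h hf <-]; rewrite -integralT_nnsfun.
pose u x := (a^-1 * Num.max (h x - c) 0)%R.
have u0 x : (0 <= u x)%R.
  apply: mulr_ge0; first by rewrite invr_ge0 ltW.
  by rewrite le_max lexx orbT.
have u_meas : measurable_fun setT u.
  apply: measurable_funM => //; apply: measurable_maxr => //.
  exact: measurable_funB.
have ug x : (u x <= g x)%R.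
  rewrite /u mulrC ler_pdivrMr// ge_max mulr_ge0 ?(ltW a0)// andbT.
  rewrite lerBlDr mulrC; apply: le_trans (fg x).
  by rewrite -lee_fin; exact: hf.
apply: (@le_trans _ _ (\int[P]_x (a%:E * (u x)%:E + cst c%:E x))).
  apply: ge0_le_integral_nonmeas => x; first by rewrite lee_fin.
  by rewrite /= lee_fin /u mulVKf ?gt_eqF// -lerBlDr le_max lexx.
have uE0 x : setT x -> 0 <= (u x)%:E by rewrite lee_fin.
have muE : measurable_fun setT (EFin \o u) by exact/measurable_EFinP.
have auE0 x : setT x -> 0 <= a%:E * (u x)%:E.
  by move=> _; rewrite mule_ge0 ?lee_fin// ltW.
have cE0 (x : T) : setT x -> 0 <= cst c%:E x by rewrite lee_fin.
have mau : measurable_fun setT (fun x => a%:E * (u x)%:E) by exact: measurable_funeM.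
rewrite (ge0_integralD P measurableT auE0 mau cE0 (measurable_cst _)).
rewrite (ge0_integralZl_EFin P measurableT uE0 muE (ltW a0)).
rewrite integral_cst// [X in c%:E * X](probability_setT P) mule1 leeD2r//.
apply: lee_wpmul2l; first by rewrite lee_fin ltW.
by apply: ge0_le_integral_nonmeas => x; rewrite lee_fin.
Qed.

End integral_nonmeasurable.

Unset Implicit Arguments.
Set Strict Implicit.

Theorem theorem10
  (R : realType) (n m : nat) (F : 'I_m -> 'cV[R]_n -> R)
  (* smoothness of the F_i (only differentiability is used; see NOTES.md) *)
  (HF : forall i x, differentiable (F i) x)
  (LF lF MG Pg sigma : R)
  (* (A3) *)
  (HLF : 0 < LF) (HlF : 0 < lF)
  (HA3a : forall i x y,
     enorm (grad (F i) x - grad (F i) y) <= LF * enorm (x - y))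
  (HA3b : forall i x y, `|F i x ^+ 2 - F i y ^+ 2| <= lF * enorm (x - y))
  (* (A4) *)
  (HMG : 0 < MG)
  (HA4 : forall x (B : {set 'I_m}), (0 < #|B|)%N ->
     opnorm (Gjac F x B) <= MG)
  (* (A5) *)
  (HPg : 0 < Pg)
  (HA5 : forall x (B : {set 'I_m}), (0 < #|B|)%N ->
     ghat1 F x B <= Pg)
  (* (A6) *)
  (Hsigma : 0 < sigma)
  (HA6 : forall x,
     Eq 1 (fun B => `|ghat2 F x B - fhat2 F x| ^+ 2)
       <= sigma ^+ 2)
  (* parameters of Scheme 3 *)
  (gamma L : R) (b : nat)
  (Hgamma : 1 <= gamma) (HL0 : 0 < L) (HL1 : L <= gamma * LF)
  (Hb : (1 <= b <= m)%N)
  (eta : R) (etas : nat -> R)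
  (Heta : 0 < eta <= 1) (Hetas : forall k, eta <= etas k <= 1)
  (* the iterates of Scheme 3 with rule (15), tau_k = ghat1(x_k,B_k),
     as a function of x_0 and of the batch sequence *)
  (xs : 'cV[R]_n -> (nat -> {set 'I_m}) -> nat -> 'cV[R]_n)
  (Hxs : forall x0 (Bs : nat -> {set 'I_m}), (forall j, #|Bs j| = b) ->
     exists Ls : nat -> R,
       scheme3_run F gamma LF L etas Bs x0 (xs x0 Bs) Ls)
  (* random initial point x_0, independent of the batches *)
  (d : measure_display) (Omega : measurableType d) (P : probability Omega R)
  (x0 : Omega -> 'cV[R]_n)
  (Hx0 : forall i : 'I_n, measurable_fun setT (fun w => x0 w i 0))
  (k : nat) (Hk : (0 < k)%N) :
  let gnorm2 := fun y => enorm (grad (fhat2 F) y) ^+ 2 in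
  let sigt := sigma * Num.sqrt (m%:R / (m%:R - 1)) in
  (\int[P]_w
     (Ebatches b k (fun Bs =>
        \big[Num.min/gnorm2 (xs (x0 w) Bs 0%N)]_(i < k)
           gnorm2 (xs (x0 w) Bs i)))%:E
   <= (8 * (MG ^+ 2 + gamma * Pg * LF) / (eta * (2 - eta)))%:E *
      ((k%:R^-1)%:E * (\int[P]_w (fhat2 F (x0 w))%:E)
       + (2 * lF * Num.min (Num.sqrt (2 * Pg / L)) (MG / L)
            * (if (b < m)%N then 1 else 0)
          + sigt * Num.sqrt (b%:R^-1 - m%:R^-1))%:E))%E.
Proof.
cbv zeta.
have k0 : (0 < k%:R^-1 :> R) by rewrite invr_gt0 ltr0n.
set C := 8 * _ / _; set dl := _ * (if _ then _ else _); set sg := sigma * _ * _.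
have C0 : 0 < C.
  case/andP: Heta => e0 e1; rewrite divr_gt0//.
    rewrite mulr_gt0// ltr_wpDr ?exprn_gt0// mulrAC mulr_ge0 ?(ltW HPg)//.
    exact: le_trans (ltW HL0) HL1.
  by rewrite mulr_gt0//; lra.
have dl0 : 0 <= dl by apply: step_bias_ge0.
have sg0 : 0 <= sg by rewrite !mulr_ge0 ?sqrtr_ge0// ltW.
apply: (@le_trans _ _ ((C * k%:R^-1)%:E * (\int[P]_w (fhat2 F (x0 w))%:E) + (C * dl)%:E)%E).
  apply: integral_le_affine_nonmeas => [||w|w|w].
  - exact: mulr_gt0.
  - by rewrite mulr_ge0// ltW.
  - rewrite /Ebatches divr_ge0// sumr_ge0// => t _.
    by apply/bigmin_geP; split=> *; exact: sqr_ge0.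
  - exact: sqr_ge0.
  rewrite -mulrA -mulrDr; exact: Ebatches_min_gradient_le.
have I0 : (0 <= \int[P]_w (fhat2 F (x0 w))%:E)%E.
  by apply: integral_ge0 => w _; rewrite lee_fin sqr_ge0.
have kI0 : (0 <= (k%:R^-1)%:E * \int[P]_w (fhat2 F (x0 w))%:E)%E.
  by rewrite mule_ge0// lee_fin ltW.
have ds0 : (0 <= (dl + sg)%:E)%E by rewrite lee_fin addr_ge0.
rewrite (ge0_muleDr C%:E kI0 ds0).
rewrite muleA -EFinM leeD2l// -EFinM lee_fin ler_wpM2l ?(ltW C0)//.
by rewrite lerDl.
Qed.
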